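(* Let $m$ be a positive integer and $\lambda$ a nonzero real number. For integers $0\le k\le n$, $$m^{n-k}S_{1,\lambda/m}(n,k)=\sum_{i=k}^{n}\binom{i}{k}V_{m,\lambda}(n,i)\,(1)_{i-k,\lambda}.$$
   Context: For a nonzero real $\mu$: $(x)_{0,\mu}=1$, $(x)_{n,\mu}=x(x-\mu)\cdots(x-(n-1)\mu)$; $(x)_n=(x)_{n,1}$. Degenerate Stirling numbers of the first kind: $(x)_n=\sum_{l=0}^{n}S_{1,\mu}(n,l)(x)_{l,\mu}$. Degenerate Whitney numbers of the first kind $V_{m,\lambda}(n,k)$: $m^{n}(x)_{n}=\sum_{k=0}^{n}V_{m,\lambda}(n,k)(mx+1)_{k,\lambda}$. *)

(* Defs.v *)
From mathcomp Require Import all_boot all_order all_algebra.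
From mathcomp Require Import reals.
From mathcomp Require Import ring.
Set Implicit Arguments.
Unset Strict Implicit.
Unset Printing Implicit Defensive.
Import Order.TTheory GRing.Theory Num.Theory.
Local Open Scope ring_scope.

(* (x)_{n,mu} = x (x - mu) ... (x - (n-1) mu) *)
Definition dfall (R : realType) (mu x : R) (n : nat) : R :=
  \prod_(i < n) (x - i%:R * mu).

(* S1 n l = S_{1,mu}(n,l); values outside l <= n are left unconstrained. *)
Definition is_degenerate_stirling1 (R : realType) (mu : R)
    (S1 : nat -> nat -> R) : Prop :=
  forall (n : nat) (x : R),
    dfall 1 x n = \sum_(0 <= l < n.+1) S1 n l * dfall mu x l.

(* V n k = V_{m,lambda}(n,k); values outside k <= n are left unconstrained. *)
Definition is_degenerate_whitney1 (R : realType) (m : nat) (lambda : R)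
    (V : nat -> nat -> R) : Prop :=
  forall (n : nat) (x : R),
    m%:R ^+ n * dfall 1 x n =
      \sum_(0 <= k < n.+1) V n k * dfall lambda (m%:R * x + 1) k.

(* The next lemmas show that both families exist, so that hypotheses of the
   two forms above are not vacuous. *)
Lemma connection_coef_exists (R : realType) (a u : R) (c v : nat -> R)
    (f b : nat -> R -> R) (ha : a != 0)
    (hf0 : forall x, f 0 x = 1) (hb0 : forall x, b 0 x = 1)
    (hf : forall n x, f n.+1 x = f n x * (u * x + v n))
    (hb : forall n x, b n.+1 x = b n x * (a * x + c n)) :
  exists s : nat -> nat -> R,
    forall n x, f n x = \sum_(0 <= l < n.+1) s n l * b l x.
Proof.
suff H n : exists s : nat -> R,
    forall x, f n x = \sum_(0 <= l < n.+1) s l * b l x.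
  by have [s hs] := boolp.choice H; exists s.
elim: n => [|n [s hs]].
  by exists (fun=> 1) => x; rewrite big_nat1 hf0 hb0 mulr1.
pose s1 l := if l is l'.+1 then u / a * s l' else 0.
pose s2 l := if (l <= n)%N then (v n - u * c l / a) * s l else 0.
exists (fun l => s1 l + s2 l) => x.
rewrite hf hs mulr_suml.
under [RHS]eq_bigr do rewrite mulrDl.
rewrite [RHS]big_split /= [X in _ = X + _]big_nat_recl //= mul0r add0r.
rewrite [X in _ = _ + X]big_nat_recr //= {2}/s2 ltnn mul0r addr0 -big_split /=.
apply: eq_big_nat => l /andP[_ hl]; rewrite /s2 -ltnS hl hb.
by field.
Qed.

Lemma dfallS (R : realType) (mu x : R) (n : nat) :
  dfall mu x n.+1 = dfall mu x n * (x - n%:R * mu).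
Proof. by rewrite /dfall big_ord_recr. Qed.

Lemma degenerate_stirling1_exists (R : realType) (mu : R) :
  exists S1 : nat -> nat -> R, is_degenerate_stirling1 mu S1.
Proof.
apply: (@connection_coef_exists R 1 1 (fun n => - (n%:R * mu))
  (fun n => - n%:R) (fun n x => dfall 1 x n) (fun n x => dfall mu x n)).
- exact: oner_neq0.
- by move=> x; rewrite /dfall big_ord0.
- by move=> x; rewrite /dfall big_ord0.
- by move=> n x; rewrite dfallS; ring.
- by move=> n x; rewrite dfallS; ring.
Qed.

Lemma degenerate_whitney1_exists (R : realType) (m : nat) (lambda : R)
    (hm : (0 < m)%N) :
  exists V : nat -> nat -> R, is_degenerate_whitney1 m lambda V.
Proof.
apply: (@connection_coef_exists R m%:R m%:R (fun n => 1 - n%:R * lambda)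
  (fun n => - (m%:R * n%:R)) (fun n x => m%:R ^+ n * dfall 1 x n)
  (fun n x => dfall lambda (m%:R * x + 1) n)).
- by rewrite pnatr_eq0 -lt0n.
- by move=> x; rewrite /dfall big_ord0 mulr1.
- by move=> x; rewrite /dfall big_ord0.
- by move=> n x; rewrite dfallS exprS; ring.
- by move=> n x; rewrite dfallS; ring.
Qed.

(* Main.v *)
(** Substituting [y = m x] in both defining identities expands
    [m ^ n (x)_n] in two ways over the basis [(y)_{k,lambda}]: directly
    for the Stirling numbers, and for the Whitney numbers through the Vandermonde
    identity for [(y + 1)_{i,lambda}]. The coefficients agree because evaluating
    at [y = 0, lambda, 2 lambda, ...] gives a triangular system with nonzero
    diagonal entries [k! lambda ^ k]. *)

Require Import Defs.
From mathcomp Require Import all_boot all_order all_algebra.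
From mathcomp Require Import reals.
From mathcomp Require Import ring.
Import Order.TTheory GRing.Theory Num.Theory.
Local Open Scope ring_scope.

Lemma dfall0 (R : realType) (mu x : R) : dfall mu x 0 = 1.
Proof. by rewrite /dfall big_ord0. Qed.

Lemma dfall_scale (R : realType) (a mu x : R) (n : nat) :
  dfall (a * mu) (a * x) n = a ^+ n * dfall mu x n.
Proof.
elim: n => [|n IHn]; first by rewrite !dfall0 mulr1.
by rewrite !dfallS IHn exprS; ring.
Qed.

(** Induction via [x + y - n mu = (x - k mu) + (y - (n - k) mu)]: each term raises the index of
    either factor, and Pascal's rule recombines them. *)
Lemma dfallD (R : realType) (mu x y : R) (n : nat) :
  dfall mu (x + y) n =
    \sum_(0 <= k < n.+1) 'C(n, k)%:R * dfall mu x k * dfall mu y (n - k).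
Proof.
elim: n => [|n IHn]; first by rewrite big_nat1 !dfall0 !mulr1.
rewrite dfallS IHn mulr_suml [RHS]big_nat_recl //=.
under [X in _ = _ + X]eq_bigr do rewrite binS natrD 2!mulrDl subSS.
rewrite big_split /= addrA.
(* One half of Pascal's rule, reindexed to absorb the [k = 0] term; its top term vanishes since
   ['C(n, n.+1) = 0]. *)
pose F k := 'C(n, k)%:R * dfall mu x k * dfall mu y (n.+1 - k).
have -> : 'C(n.+1, 0)%:R * dfall mu x 0 * dfall mu y (n.+1 - 0) +
    \sum_(0 <= k < n.+1)
      'C(n, k.+1)%:R * dfall mu x k.+1 * dfall mu y (n - k) =
    \sum_(0 <= k < n.+2) F k.
  by rewrite [RHS]big_nat_recl // /F !bin0.
rewrite [X in _ = X + _]big_nat_recr //= {2}/F (bin_small (ltnSn n)) !mul0r addr0 -big_split /=.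
apply: eq_big_nat => k /andP[_ hk].
by rewrite /F subSn // !dfallS natrB //; ring.
Qed.

Lemma dfall_natmul_small (R : realType) (mu : R) (j n : nat) :
  (j < n)%N -> dfall mu (j%:R * mu) n = 0.
Proof.
by move=> lt_jn; rewrite /dfall (bigD1 (Ordinal lt_jn)) //= subrr mul0r.
Qed.

Lemma dfall_natmul_neq0 (R : realType) (mu : R) (n : nat) :
  mu != 0 -> dfall mu (n%:R * mu) n != 0.
Proof.
move=> mu0; apply/prodf_neq0 => i _.
by rewrite -mulrBl mulf_neq0 // subr_eq0 eqr_nat gtn_eqF.
Qed.

Lemma dfall_free (R : realType) (mu : R) (c : nat -> R) (n : nat) :
  mu != 0 -> (forall y, \sum_(0 <= k < n) c k * dfall mu y k = 0) ->
  forall k, (k < n)%N -> c k = 0.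
Proof.
move=> mu0 hc; elim/ltn_ind=> k IHk lt_kn.
(* At this point the terms below [k] vanish by induction, those above [k] because they have [k * mu]
   as a root. *)
have := hc (k%:R * mu).
rewrite big_mkord (bigD1 (Ordinal lt_kn)) //= big1 ?addr0 => [|i neq_ik].
  by move/eqP; rewrite mulf_eq0 (negPf (dfall_natmul_neq0 _ _ k mu0)) orbF => /eqP.
have [lt_ik|lt_ki|eq_ik] := ltngtP i k.
- by rewrite IHk ?mul0r.
- by rewrite dfall_natmul_small ?mulr0.
- by case/eqP: neq_ik; apply: val_inj.
Qed.

Theorem theorem20 (R : realType) (m : nat) (lambda : R)
    (S1 V : nat -> nat -> R)
    (hm : (0 < m)%N) (hlambda : lambda != 0)
    (hS : is_degenerate_stirling1 (lambda / m%:R) S1)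
    (hV : is_degenerate_whitney1 m lambda V)
    (n k : nat) (hkn : (k <= n)%N) :
  m%:R ^+ (n - k) * S1 n k =
    \sum_(k <= i < n.+1) 'C(i, k)%:R * V n i * dfall lambda 1 (i - k).
Proof.
have m0 : m%:R != 0 :> R by rewrite pnatr_eq0 -lt0n.
(* Starting at [0] makes the range independent of [j], so that the sums can be exchanged; the added
   terms have [i < j] and a zero binomial. *)
pose w j := \sum_(0 <= i < n.+1) 'C(i, j)%:R * V n i * dfall lambda 1 (i - j).
have -> : \sum_(k <= i < n.+1) 'C(i, k)%:R * V n i * dfall lambda 1 (i - k)
          = w k.
  rewrite /w [RHS](big_cat_nat (n := k)) //=; last exact: leqW.
  rewrite [X in _ = X + _]big_nat [X in _ = X + _]big1 ?add0r // => i.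
  by case/andP=> _ lt_ik; rewrite bin_small // !mul0r.
apply/eqP; rewrite -subr_eq0; apply/eqP.
apply: (dfall_free _ lambda (fun j => m%:R ^+ (n - j) * S1 n j - w j)
  n.+1) => //.
move=> y; pose x := y / m%:R.
have mx : m%:R * x = y by rewrite mulrC divfK.
under eq_bigr do rewrite mulrBl.
rewrite big_split /= sumrN; apply/eqP; rewrite subr_eq0; apply/eqP.
transitivity (m%:R ^+ n * dfall 1 x n).
  rewrite hS mulr_sumr; apply: eq_big_nat => j /andP[_ lt_jn].
  (* Both [y] and [lambda] are written as [m] times [x] and [lambda / m], which pulls out
     [m ^ j]. *)
  rewrite -{1}mx -{1}(divfK m0 lambda) (mulrC _ m%:R) dfall_scale.
  have -> : m%:R ^+ n = m%:R ^+ (n - j) * m%:R ^+ j :> R.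
    by rewrite -exprD subnK.
  ring.
rewrite hV mx; under [RHS]eq_bigr do rewrite mulr_suml.
rewrite [RHS]exchange_big_nat /=.
apply: eq_big_nat => i /andP[_ lt_in].
(* Zero binomials for [j > i] cut the inner sum down to the Vandermonde range. *)
rewrite dfallD mulr_sumr [RHS](big_cat_nat (n := i.+1)) //=.
rewrite [X in _ = _ + X]big_nat [X in _ = _ + X]big1 ?addr0 => [|j].
  by apply: eq_bigr => j _; ring.
by case/andP=> lt_ij _; rewrite bin_small // !mul0r.
Qed.
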